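(* Fix constants $0\le\delta\le1$, $\gamma>0$, $M>0$, $\alpha>1$. There is a constant $X_0$ (depending only on these fixed constants, not on $E,P,Q$) such that the following holds. Let $E/\mathbb{Q}$ be given by the model $y^2=x^3+Ax+B$ ($A,B\in\mathbb{Z}$) described in the context, with $X=\max\{|A|^3,|B|^2\}\ge X_0$. Let $P,Q\in E(\mathbb{Q})$ satisfy $X^{1/6}\le x(P)<x(Q)$, $x(P)=x_1/s$, $x(Q)=x_2/s$ with $x_1,x_2\in\mathbb{Z}$, $s$ a positive integer, $\gcd(x_1,s)\le s^\delta$, $\gcd(x_2,s)\le s^\delta$, and $$h(s)\le\tfrac1\gamma\log X,\qquad \hat{h}(P),\hat{h}(Q)>M\log X,\qquad \max\Big\{\tfrac{\hat{h}(Q)}{\hat{h}(P)},\tfrac{\hat{h}(P)}{\hat{h}(Q)}\Big\}\le\alpha.$$ Then $$\cos\theta_{P,Q}\le \frac{\sqrt\alpha}{2}+\frac{3\delta}{2M\gamma}+\frac1M.$$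
   Context: The model is obtained from a global minimal Weierstrass equation of $E$ by the substitution $x\mapsto \frac{1}{36}(x-3b_2)$, $y\mapsto \frac12(\frac{y}{108}-\frac{a_1}{36}(x-3b_2)-a_3)$. $h$ is the absolute logarithmic Weil height, $h(P)=h(x(P))$, $\hat{h}(P)=\lim_{n\to\infty}h(2^nP)/4^n$ (not normalized by $1/2$). For non-torsion $P,Q\in E(\mathbb{Q})$, $\cos\theta_{P,Q}:=\dfrac{\hat{h}(P+Q)-\hat{h}(P)-\hat{h}(Q)}{2\sqrt{\hat{h}(P)\hat{h}(Q)}}$. *)

(* Defs.v *)
From HB Require Import structures.
From mathcomp Require Import all_boot all_order all_algebra.
From mathcomp Require Import all_classical all_reals all_analysis.
Set Implicit Arguments. Unset Strict Implicit. Unset Printing Implicit Defensive.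
Import Order.TTheory GRing.Theory Num.Theory.
Import numFieldNormedType.Exports.
Local Open Scope ring_scope.

Definition wb2 (K : comNzRingType) (a1 a2 a3 a4 a6 : K) : K := a1 ^+ 2 + 4 * a2.
Definition wb4 (K : comNzRingType) (a1 a2 a3 a4 a6 : K) : K := 2 * a4 + a1 * a3.
Definition wb6 (K : comNzRingType) (a1 a2 a3 a4 a6 : K) : K := a3 ^+ 2 + 4 * a6.
Definition wb8 (K : comNzRingType) (a1 a2 a3 a4 a6 : K) : K :=
  a1 ^+ 2 * a6 + 4 * a2 * a6 - a1 * a3 * a4 + a2 * a3 ^+ 2 - a4 ^+ 2.
Definition wc4 (K : comNzRingType) (a1 a2 a3 a4 a6 : K) : K :=
  wb2 a1 a2 a3 a4 a6 ^+ 2 - 24 * wb4 a1 a2 a3 a4 a6.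
Definition wc6 (K : comNzRingType) (a1 a2 a3 a4 a6 : K) : K :=
  - wb2 a1 a2 a3 a4 a6 ^+ 3 + 36 * wb2 a1 a2 a3 a4 a6 * wb4 a1 a2 a3 a4 a6
  - 216 * wb6 a1 a2 a3 a4 a6.
Definition wdisc (K : comNzRingType) (a1 a2 a3 a4 a6 : K) : K :=
  let b2 := wb2 a1 a2 a3 a4 a6 in let b4 := wb4 a1 a2 a3 a4 a6 in
  let b6 := wb6 a1 a2 a3 a4 a6 in let b8 := wb8 a1 a2 a3 a4 a6 in
  - b2 ^+ 2 * b8 - 8 * b4 ^+ 3 - 27 * b6 ^+ 2 + 9 * b2 * b4 * b6.

(* Coefficients of the Weierstrass equation obtained from (a1,...,a6) by the
   change of variables x = u^2 x' + r, y = u^3 y' + s u^2 x' + t. *)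
Definition chg_a1 (u r s t a1 a2 a3 a4 a6 : rat) : rat := (a1 + 2 * s) / u.
Definition chg_a2 (u r s t a1 a2 a3 a4 a6 : rat) : rat :=
  (a2 - s * a1 + 3 * r - s ^+ 2) / u ^+ 2.
Definition chg_a3 (u r s t a1 a2 a3 a4 a6 : rat) : rat :=
  (a3 + r * a1 + 2 * t) / u ^+ 3.
Definition chg_a4 (u r s t a1 a2 a3 a4 a6 : rat) : rat :=
  (a4 - s * a3 + 2 * r * a2 - (t + r * s) * a1 + 3 * r ^+ 2 - 2 * s * t)
  / u ^+ 4.
Definition chg_a6 (u r s t a1 a2 a3 a4 a6 : rat) : rat :=
  (a6 + r * a4 + r ^+ 2 * a2 + r ^+ 3 - t * a3 - t ^+ 2 - r * t * a1)
  / u ^+ 6.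

Definition global_minimal (a1 a2 a3 a4 a6 : int) : Prop :=
  let q1 : rat := a1%:~R in let q2 : rat := a2%:~R in
  let q3 : rat := a3%:~R in let q4 : rat := a4%:~R in
  let q6 : rat := a6%:~R in
  wdisc a1 a2 a3 a4 a6 != 0 /\
  forall u r s t : rat, u != 0 ->
    let b1 := chg_a1 u r s t q1 q2 q3 q4 q6 in
    let b2 := chg_a2 u r s t q1 q2 q3 q4 q6 in
    let b3 := chg_a3 u r s t q1 q2 q3 q4 q6 in
    let b4 := chg_a4 u r s t q1 q2 q3 q4 q6 in
    let b6 := chg_a6 u r s t q1 q2 q3 q4 q6 in
    [/\ b1 \is a Num.int, b2 \is a Num.int, b3 \is a Num.int,
        b4 \is a Num.int & b6 \is a Num.int] ->
    `|wdisc q1 q2 q3 q4 q6| <= `|wdisc b1 b2 b3 b4 b6|.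

(* The short model y^2 = x^3 + A x + B obtained from the minimal model by
   x |-> (x - 3 b2)/36, y |-> (y/108 - a1 (x - 3 b2)/36 - a3)/2:
   A = -27 c4, B = -54 c6. *)
Definition modelA (a1 a2 a3 a4 a6 : int) : int := - 27 * wc4 a1 a2 a3 a4 a6.
Definition modelB (a1 a2 a3 a4 a6 : int) : int := - 54 * wc6 a1 a2 a3 a4 a6.
Definition bigX (A B : int) : int := Num.max (`|A| ^+ 3) (`|B| ^+ 2).

Definition ecpoint := option (rat * rat).

Definition on_curve (A B : int) (P : ecpoint) : bool :=
  match P with
  | None => true
  | Some (x, y) => y ^+ 2 == x ^+ 3 + A%:~R * x + B%:~R
  end.

Definition padd (A B : int) (P Q : ecpoint) : ecpoint :=
  match P, Q with
  | None, _ => Q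
  | _, None => P
  | Some (x1, y1), Some (x2, y2) =>
      if (x1 == x2) && (y1 == - y2) then None
      else
        let l := if x1 == x2 then (3 * x1 ^+ 2 + A%:~R) / (2 * y1)
                 else (y2 - y1) / (x2 - x1) in
        let x3 := l ^+ 2 - x1 - x2 in
        Some (x3, l * (x1 - x3) - y1)
  end.

Section Heights.
Variable R : realType.

Definition hrat (x : rat) : R := ln ((maxn `|numq x|%N `|denq x|%N)%:R).

Definition hpt (P : ecpoint) : R :=
  match P with None => 0 | Some (x, _) => hrat x end.

(* canonical height (not normalized by 1/2): lim h(2^n P)/4^n *)
Definition hhat (A B : int) (P : ecpoint) : R :=
  limn (fun n : nat => hpt (iter n (fun T => padd A B T T) P) / 4 ^+ n).

Definition cos_theta (A B : int) (P Q : ecpoint) : R :=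
  (hhat A B (padd A B P Q) - hhat A B P - hhat A B Q)
  / (2 * Num.sqrt (hhat A B P * hhat A B Q)).
End Heights.

(* Main.v *)
(** Write [T = X^(1/6)], so that [|A| <= T^2] and [|B| <= T^3], and weigh the
    height as [wht (a/b) = ln max(|a|, T|b|)]; it agrees with [h] when
    [x >= T].  In these coordinates the duplication map has bounded
    coefficients, so doubling costs at most [ln 12] above; the resultant
    identities bound its loss below by [ln (619 X)], because the factor
    [4 |4A^3 + 27B^2|] appearing in the archimedean bound cancels against the
    largest possible common divisor.  Tate's limit then gives
    [wht - (ln X + O(1))/3 <= hhat <= wht + O(1)].

    With [x(P) = n1/s] and [x(Q) = n2/s], the chord formula has numerator at
    most [12 n1 n2^2], so [hhat (P+Q) <= ln n1 + 2 ln n2 + O(1)], and cancelling the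
    gcds gives [ln n_i <= hhat + (ln X)/3 + (delta/gamma) ln X + O(1)].
    Altogether [hhat (P+Q) <= hhat P + 2 hhat Q + 3 (delta/gamma) ln X + ln X + O(1)], and
    one more [ln X] absorbs the constant.  *)
Require Import Defs.
From HB Require Import structures.
From mathcomp Require Import all_boot all_order all_algebra.
From mathcomp Require Import all_classical all_reals all_analysis.
From mathcomp Require Import ring lra.
Import Order.TTheory GRing.Theory Num.Theory.
Import numFieldNormedType.Exports.
Set Implicit Arguments. Unset Strict Implicit. Unset Printing Implicit Defensive.
Local Open Scope ring_scope.

(** * Duplication polynomials *)

Section Duplication.
Variable K : comNzRingType.
Implicit Types A B a b : K.

(** The duplication formula, homogenized: [x(P) = a / b] gives [x(2P) = dup_num / dup_den] when [2P]
    is finite. *)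
Definition dup_num A B a b : K :=
  a ^+ 4 - 2 * A * a ^+ 2 * b ^+ 2 - 8 * B * a * b ^+ 3 + A ^+ 2 * b ^+ 4.
Definition dup_den A B a b : K :=
  4 * b * (a ^+ 3 + A * a * b ^+ 2 + B * b ^+ 3).
Definition cubic_disc A B : K := 4 * A ^+ 3 + 27 * B ^+ 2.

(* Cofactors from Silverman, The Arithmetic of Elliptic Curves, VIII.4.3. *)
Definition bez1 A B a b : K := 12 * a ^+ 2 * b + 16 * A * b ^+ 3.
Definition bez2 A B a b : K :=
  3 * a ^+ 3 - 5 * A * a * b ^+ 2 - 27 * B * b ^+ 3.
Definition bez3 A B a b : K :=
  4 * (4 * A ^+ 3 + 27 * B ^+ 2) * a ^+ 3 - 4 * A ^+ 2 * B * a ^+ 2 * b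
  + 4 * A * (3 * A ^+ 3 + 22 * B ^+ 2) * a * b ^+ 2
  + 12 * B * (A ^+ 3 + 8 * B ^+ 2) * b ^+ 3.
Definition bez4 A B a b : K :=
  A ^+ 2 * B * a ^+ 3 + A * (5 * A ^+ 3 + 32 * B ^+ 2) * a ^+ 2 * b
  + 2 * B * (13 * A ^+ 3 + 96 * B ^+ 2) * a * b ^+ 2
  - 3 * A ^+ 2 * (A ^+ 3 + 8 * B ^+ 2) * b ^+ 3.

Lemma dup_bezout_den A B a b :
  bez1 A B a b * dup_num A B a b - bez2 A B a b * dup_den A B a b
  = 4 * cubic_disc A B * b ^+ 7.
Proof. by rewrite /bez1 /bez2 /dup_num /dup_den /cubic_disc; ring. Qed.

Lemma dup_bezout_num A B a b :
  bez3 A B a b * dup_num A B a b + bez4 A B a b * dup_den A B a b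
  = 4 * cubic_disc A B * a ^+ 7.
Proof. by rewrite /bez3 /bez4 /dup_num /dup_den /cubic_disc; ring. Qed.

End Duplication.

(** This is [c4^3 - c6^2 = 1728 disc] with [A = -27 c4] and [B = -54 c6]; it carries nonsingularity
    from the minimal model to the short one. *)
Lemma cubic_disc_model a1 a2 a3 a4 a6 :
  cubic_disc (modelA a1 a2 a3 a4 a6) (modelB a1 a2 a3 a4 a6)
  = - (27 ^+ 3 * 4 * 1728) * wdisc a1 a2 a3 a4 a6.
Proof.
rewrite /cubic_disc /modelA /modelB /wdisc /wc4 /wc6 /wb2 /wb4 /wb6 /wb8; ring.
Qed.

(** * Archimedean bounds for the duplication forms *)

Section RealBounds.
Variable R : realFieldType.
Implicit Types A B a b m x y c d : R.

Lemma normD_le x y c d : `|x| <= c -> `|y| <= d -> `|x + y| <= c + d.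
Proof. by move=> h1 h2; apply: le_trans (ler_normD _ _) (lerD h1 h2). Qed.

Lemma normM_le x y c d : `|x| <= c -> `|y| <= d -> `|x * y| <= c * d.
Proof. by move=> h1 h2; rewrite normrM ler_pM. Qed.

Lemma normX_le x c n : `|x| <= c -> `|x ^+ n| <= c ^+ n.
Proof. by move=> h; rewrite normrX lerXn2r ?nnegrE ?(le_trans _ h). Qed.

Lemma normN_le x c : `|x| <= c -> `|- x| <= c.
Proof. by rewrite normrN. Qed.

Lemma norm_nat_le n : `|n%:R : R| <= n%:R.
Proof. by rewrite normr_nat. Qed.

Ltac norm_bound :=
  lazymatch goal with
  | |- is_true (`|_ + _| <= _) => refine (normD_le _ _); norm_bound
  | |- is_true (`|- _| <= _) => refine (normN_le _); norm_bound
  | |- is_true (`|_ * _| <= _) => refine (normM_le _ _); norm_bound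
  | |- is_true (`|_ ^+ _| <= _) => refine (normX_le _ _); norm_bound
  | |- is_true (`|_%:R| <= _) => exact: norm_nat_le
  | |- _ => eassumption
  end.

Ltac poly_bound :=
  eapply le_trans;
  [norm_bound | rewrite le_eqVlt; apply/orP; left; apply/eqP; ring].

(** The constants here and in [bez_norm_le] are the sums of the absolute values of the coefficients,
    by the triangle inequality. *)
Lemma dup_norm_le A B a b m : `|A| <= 1 -> `|B| <= 1 -> `|a| <= m -> `|b| <= m ->
  `|dup_num A B a b| <= 12 * m ^+ 4 /\ `|dup_den A B a b| <= 12 * m ^+ 4.
Proof. by move=> hA hB ha hb; split; rewrite /dup_num /dup_den; poly_bound. Qed.

Lemma bez_norm_le A B a b m : `|A| <= 1 -> `|B| <= 1 -> `|a| <= m -> `|b| <= m ->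
  [/\ `|bez1 A B a b| <= 28 * m ^+ 3, `|bez2 A B a b| <= 35 * m ^+ 3,
      `|bez3 A B a b| <= 336 * m ^+ 3 & `|bez4 A B a b| <= 283 * m ^+ 3].
Proof.
by move=> hA hB ha hb; split; rewrite /bez1 /bez2 /bez3 /bez4; poly_bound.
Qed.

(** Choose the Bezout identity whose right side has the seventh power of the larger of [a] and [b].
    Its cofactors are cubic, so a factor [m ^+ 3] cancels. The constant is [619 = 336 + 283]. *)
Lemma dup_norm_ge A B a b : `|A| <= 1 -> `|B| <= 1 ->
  4 * `|cubic_disc A B| * Num.max `|a| `|b| ^+ 4
  <= 619 * Num.max `|dup_num A B a b| `|dup_den A B a b|.
Proof.
move=> hA hB; set m := Num.max `|a| `|b|; set M := Num.max _ _.
have ha : `|a| <= m by rewrite le_max lexx.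
have hb : `|b| <= m by rewrite le_max lexx orbT.
have hF : `|dup_num A B a b| <= M by rewrite le_max lexx.
have hG : `|dup_den A B a b| <= M by rewrite le_max lexx orbT.
have M0 : 0 <= M by apply: le_trans hF.
have [m0|m_gt0] := leP m 0.
  have -> : m = 0 by apply/eqP; rewrite eq_le m0 (le_trans _ ha).
  by rewrite expr0n mulr0; apply: mulr_ge0 (ler0n _ _) M0.
have [h1 h2 h3 h4] := @bez_norm_le A B a b m hA hB ha hb.
have m3 : 0 < m ^+ 3 by rewrite exprn_gt0.
rewrite -(ler_pM2r m3).
have -> : 4 * `|cubic_disc A B| * m ^+ 4 * m ^+ 3 = `|4 * cubic_disc A B| * m ^+ 7.
  by rewrite normrM normr_nat; ring.
have Mm : 0 <= M * m ^+ 3 by apply: mulr_ge0 => //; exact: ltW.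
have : m = `|a| \/ m = `|b| by rewrite /m maxEle; case: ifP; auto.
clearbody m M.
move=> [{1}->|{1}->]; rewrite -normrX -normrM.
  rewrite -(dup_bezout_num A B a b).
  apply: le_trans (normD_le (normM_le h3 hF) (normM_le h4 hG)) _.
  by rewrite le_eqVlt; apply/orP; left; apply/eqP; ring.
rewrite -(dup_bezout_den A B a b).
apply: le_trans (normD_le (normM_le h1 hF) (normN_le (normM_le h2 hG))) _.
(* This identity only needs the constant [28 + 35 = 63]. *)
by move: Mm => *; lra.
Qed.

End RealBounds.

(** * Cancellation in fractions and common divisors of the duplication forms *)

Lemma rat_mul_intP (x : rat) (n d : int) : d != 0 -> x * d%:~R = n%:~R ->
  exists2 k : int, k != 0 & n = k * numq x /\ d = k * denq x.
Proof.
move=> d0 xd.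
have e : n * denq x = numq x * d.
  apply: (@intr_inj rat); rewrite !intrM numqE -xd; ring.
have /dvdzP[k dk] : (denq x %| d)%Z.
  rewrite -(@Gauss_dvdzr _ (numq x)); last first.
    by rewrite coprimez_sym /coprimez /gcdz; exact: coprime_num_den.
  by rewrite -e dvdz_mull.
exists k; first by apply: contraNneq d0 => k0; rewrite dk k0 mul0r.
split=> //; apply: (mulIf (denq_neq0 x)); rewrite e dk; ring.
Qed.

(** Both [4 * cubic_disc A B * a ^+ 7] and [4 * cubic_disc A B * b ^+ 7] are multiples of [k] by the
    two Bezout identities, and [a ^+ 7], [b ^+ 7] are coprime. *)
Lemma dup_gcd_dvd (A B a b k : int) : coprimez a b ->
  (k %| dup_num A B a b)%Z -> (k %| dup_den A B a b)%Z ->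
  (k %| 4 * cubic_disc A B)%Z.
Proof.
move=> ab; have := dup_bezout_num A B a b; have := dup_bezout_den A B a b.
move: (dup_num _ _ _ _) (dup_den _ _ _ _) (4 * _) => F G D.
move=> eb ea /dvdzP[f Ff] /dvdzP[g Gg]; rewrite {F}Ff {G}Gg in ea eb.
have /coprimezP[[u v] /= uv] : coprimez (a ^+ 7) (b ^+ 7).
  by rewrite coprimezXl ?coprimezXr.
apply/dvdzP; exists (u * (bez3 A B a b * f + bez4 A B a b * g)
  + v * (bez1 A B a b * f - bez2 A B a b * g)).
rewrite -[D in LHS]mulr1 -uv.
transitivity (u * (D * a ^+ 7) + v * (D * b ^+ 7)); first by ring.
by rewrite -ea -eb; ring.
Qed.

(** * Weighted size of a fraction under duplication *)

Section Size.
Variable R : realType.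
Implicit Types (T : R) (a b A B k : int).

Lemma norm_int_ge1 k : k != 0 -> 1 <= `|k%:~R : R|.
Proof. by move=> k0; rewrite -intr_norm ler1z -gtz0_ge1 normr_gt0. Qed.

(** The sup norm of [(a, T b)], which represents [x / T] on the curve rescaled to coefficients
    [A / T^2] and [B / T^3]. *)
Definition wsize T a b : R := Num.max `|a%:~R| (T * `|b%:~R|).

Lemma wsizeM T k a b : wsize T (k * a) (k * b) = `|k%:~R| * wsize T a b.
Proof. by rewrite /wsize !intrM !normrM maxr_pMr// mulrCA. Qed.

Lemma wsize_ge0 T a b : 0 <= wsize T a b.
Proof. by rewrite le_max normr_ge0. Qed.

Lemma wsize_ge1 T a b : 1 <= T -> b != 0 -> 1 <= wsize T a b.
Proof.
move=> T1 b0; rewrite le_max; apply/orP; right.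
apply: (le_trans T1); rewrite ler_peMr ?norm_int_ge1//.
exact: le_trans T1.
Qed.

Lemma dup_scale (A B a b T : R) : T != 0 ->
  let A' := A / T ^+ 2 in let B' := B / T ^+ 3 in
  [/\ dup_num A' B' a (T * b) = dup_num A B a b,
      dup_den A' B' a (T * b) = T * dup_den A B a b &
      cubic_disc A' B' = cubic_disc A B / T ^+ 6].
Proof.
by move=> T0 /=; split; rewrite /dup_num /dup_den /cubic_disc; field.
Qed.

Lemma dup_num_intr (A B a b : int) (K : comNzRingType) :
  (dup_num A B a b)%:~R = dup_num (A%:~R : K) B%:~R a%:~R b%:~R.
Proof. by rewrite /dup_num !(rmorphB, rmorphD, rmorphM, rmorphXn)/=. Qed.

Lemma dup_den_intr (A B a b : int) (K : comNzRingType) :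
  (dup_den A B a b)%:~R = dup_den (A%:~R : K) B%:~R a%:~R b%:~R.
Proof. by rewrite /dup_den !(rmorphB, rmorphD, rmorphM, rmorphXn)/=. Qed.

Lemma cubic_disc_intr (A B : int) (K : comNzRingType) :
  (cubic_disc A B)%:~R = cubic_disc (A%:~R : K) B%:~R.
Proof. by rewrite /cubic_disc !(rmorphB, rmorphD, rmorphM, rmorphXn)/=. Qed.

Section Curve.
Variables (T : R) (A B : int).
Hypotheses (T1 : 1 <= T) (AT : `|A%:~R| <= T ^+ 2) (BT : `|B%:~R| <= T ^+ 3).

Let T0 : 0 < T. Proof. exact: lt_le_trans T1. Qed.

Let norm_scaled n (z : R) : `|z| <= T ^+ n -> `|z / T ^+ n| <= 1.
Proof.
have Tn : 0 < T ^+ n by rewrite exprn_gt0.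
by move=> h; rewrite normf_div (gtr0_norm Tn) ler_pdivrMr// mul1r.
Qed.

Lemma wsize_dup_le a b :
  wsize T (dup_num A B a b) (dup_den A B a b) <= 12 * wsize T a b ^+ 4.
Proof.
have [eF eG _] := @dup_scale A%:~R B%:~R a%:~R b%:~R _ (lt0r_neq0 T0).
have ha : `|a%:~R| <= wsize T a b by rewrite le_max lexx.
have hb : `|T * b%:~R| <= wsize T a b.
  by rewrite normrM (gtr0_norm T0) le_max lexx orbT.
have [] := dup_norm_le (norm_scaled AT) (norm_scaled BT) ha hb.
rewrite eF eG normrM (gtr0_norm T0) -dup_num_intr -dup_den_intr => hF hG.
by rewrite ge_max hF hG.
Qed.

(** [dup_norm_ge] on the rescaled curve; [T ^+ 6] appears because the discriminant has weight 6. *)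
Lemma wsize_dup_ge a b :
  4 * `|(cubic_disc A B)%:~R| * wsize T a b ^+ 4
  <= 619 * T ^+ 6 * wsize T (dup_num A B a b) (dup_den A B a b).
Proof.
have T6 : 0 < T ^+ 6 by rewrite exprn_gt0.
have [eF eG eD] := @dup_scale A%:~R B%:~R a%:~R b%:~R _ (lt0r_neq0 T0).
have := dup_norm_ge a%:~R (T * b%:~R) (norm_scaled AT) (norm_scaled BT).
rewrite eF eG eD normf_div (gtr0_norm T6) !(normrM T) (gtr0_norm T0).
rewrite -dup_num_intr -dup_den_intr -cubic_disc_intr.
rewrite -!/(wsize _ _ _) => h.
rewrite -(ler_pM2r T6) in h; apply: le_trans (le_trans h _).
  by rewrite le_eqVlt; apply/orP; left; apply/eqP; field; rewrite lt0r_neq0.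
by rewrite le_eqVlt; apply/orP; left; apply/eqP; ring.
Qed.

Hypothesis disc0 : cubic_disc A B != 0.

(** Removing the common factor [k] costs [|k|], but [k] divides [4 * cubic_disc A B], so the
    discriminant factor in [wsize_dup_ge] pays for it. *)
Lemma wsize_reduced_dup_ge a b k f g : coprimez a b -> k != 0 ->
  dup_num A B a b = k * f -> dup_den A B a b = k * g ->
  wsize T a b ^+ 4 <= 619 * T ^+ 6 * wsize T f g.
Proof.
move=> ab k0 eF eG.
have /dvdzP[q eq] : (k %| 4 * cubic_disc A B)%Z.
  by apply: dup_gcd_dvd ab _ _; rewrite ?eF ?eG dvdz_mulr.
have q0 : q != 0.
  apply: contra_neq disc0 => q0; move: eq; rewrite q0 mul0r => /eqP.
  by rewrite mulf_eq0 => /orP[|/eqP].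
have k1 : 0 < `|k%:~R : R| by rewrite normr_gt0 intr_eq0.
have := wsize_dup_ge a b; rewrite eF eG wsizeM.
have -> : 4 * `|(cubic_disc A B)%:~R : R| = `|q%:~R| * `|k%:~R|.
  rewrite -[RHS]normrM -intrM -eq intrM [RHS]normrM; congr (_ * _).
  by rewrite rmorph_nat normr_nat.
move=> h; rewrite -(ler_pM2l k1); apply: le_trans (le_trans h _); last first.
  by rewrite le_eqVlt; apply/orP; left; apply/eqP; ring.
rewrite -mulrA ler_peMl ?norm_int_ge1//.
by rewrite mulr_ge0// exprn_ge0// wsize_ge0.
Qed.

End Curve.
End Size.

(** * The weighted height and doubling *)

Section GroupLaw.
Variable F : numFieldType.
Implicit Types A B x y : F.

Lemma tangent_on_curve A B x y : y != 0 -> y ^+ 2 = x ^+ 3 + A * x + B ->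
  let l := (3 * x ^+ 2 + A) / (2 * y) in let x3 := l ^+ 2 - x - x in
  (l * (x - x3) - y) ^+ 2 = x3 ^+ 3 + A * x3 + B.
Proof.
(* Eliminating [B] through the curve equation leaves an identity of rational functions. *)
move=> y0 e; have -> : B = y ^+ 2 - x ^+ 3 - A * x by rewrite e; ring.
by move=> /=; field.
Qed.

Lemma chord_on_curve A B x1 y1 x2 y2 : x1 != x2 ->
  y1 ^+ 2 = x1 ^+ 3 + A * x1 + B -> y2 ^+ 2 = x2 ^+ 3 + A * x2 + B ->
  let l := (y2 - y1) / (x2 - x1) in let x3 := l ^+ 2 - x1 - x2 in
  (l * (x1 - x3) - y1) ^+ 2 = x3 ^+ 3 + A * x3 + B.
Proof.
move=> x12 e1 e2; have d0 : x2 - x1 != 0 by rewrite subr_eq0 eq_sym.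
have -> : B = y1 ^+ 2 - x1 ^+ 3 - A * x1 by rewrite e1; ring.
(* Two points with distinct abscissas determine [A] as well as [B]. *)
have -> : A = ((y2 ^+ 2 - x2 ^+ 3) - (y1 ^+ 2 - x1 ^+ 3)) / (x2 - x1).
  by rewrite e1 e2; field.
by move=> /=; field.
Qed.

Lemma tangent_x A B a b y : y != 0 -> b != 0 ->
  y ^+ 2 = (a / b) ^+ 3 + A * (a / b) + B ->
  dup_den A B a b = 4 * y ^+ 2 * b ^+ 4 /\
  (((3 * (a / b) ^+ 2 + A) / (2 * y)) ^+ 2 - a / b - a / b) * dup_den A B a b
  = dup_num A B a b.
Proof.
move=> y0 b0 e; have -> : B = y ^+ 2 - (a / b) ^+ 3 - A * (a / b).
  by rewrite e; ring.
rewrite /dup_den /dup_num; split; field; rewrite ?b0 //.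
Qed.
End GroupLaw.

Lemma on_curve_double A B P : on_curve A B P -> on_curve A B (padd A B P P).
Proof.
case: P => [[x y]|//] /= /eqP e; rewrite eqxx /=.
case: ifPn => [//|yN] /=; apply/eqP; apply: tangent_on_curve e.
by apply: contra_neq yN => ->; rewrite oppr0.
Qed.

Lemma on_curve_chord A B x1 y1 x2 y2 : x1 != x2 ->
  on_curve A B (Some (x1, y1)) -> on_curve A B (Some (x2, y2)) ->
  on_curve A B (padd A B (Some (x1, y1)) (Some (x2, y2))).
Proof.
move=> x12 /eqP e1 /eqP e2; rewrite /= (negPf x12) /=; apply/eqP.
exact: chord_on_curve.
Qed.

Section WeightedHeight.
Variable R : realType.
Variable T : R.
Hypothesis T1 : 1 <= T.

Definition wht (P : ecpoint) : R :=
  if P is Some (x, _) then ln (wsize T (numq x) (denq x)) else 0.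

Lemma ler_ln_gt0 (u v : R) : 0 < u -> u <= v -> ln u <= ln v.
Proof. by move=> u0 uv; rewrite ler_ln ?posrE ?(lt_le_trans u0). Qed.

Lemma wht_ge0 P : 0 <= wht P.
Proof. by case: P => [[x y]|] //=; rewrite ln_ge0// wsize_ge1. Qed.

(** Upper bounds may thus be read off an unreduced fraction, since cancelling can only shrink the
    size. *)
Lemma wht_ratio_le (x y : rat) (n d : int) : d != 0 -> x * d%:~R = n%:~R ->
  wht (Some (x, y)) <= ln (wsize T n d).
Proof.
move=> d0 xd; have [k k0 [-> ->]] := rat_mul_intP d0 xd.
have w1 : 1 <= wsize T (numq x) (denq x) by exact: wsize_ge1.
apply: ler_ln_gt0; first exact: lt_le_trans w1.
by rewrite wsizeM ler_peMl ?norm_int_ge1// (le_trans _ w1).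
Qed.

Lemma hpt_le_wht P : hpt R P <= wht P.
Proof.
case: P => [[x y]|] //=; rewrite /hrat; apply: ler_ln_gt0.
  by rewrite ltr0n leq_max [X in _ || X]absz_gt0 denq_neq0 orbT.
rewrite /wsize natr_max !natr_absz !intr_norm le_max2//.
by rewrite ler_peMl.
Qed.

Lemma wht_le_hpt P : wht P <= hpt R P + ln T.
Proof.
have T0 : 0 < T by exact: lt_le_trans T1.
case: P => [[x y]|] /=; last by rewrite add0r ln_ge0.
have h0 : 0 < (maxn `|numq x|%N `|denq x|%N)%:R :> R.
  by rewrite ltr0n leq_max [X in _ || X]absz_gt0 denq_neq0 orbT.
rewrite /hrat -lnM ?posrE//; apply: ler_ln_gt0.
  by rewrite (lt_le_trans ltr01)// wsize_ge1.
rewrite /wsize ge_max natr_max !natr_absz !intr_norm; apply/andP; split.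
  by rewrite -[X in X <= _]mulr1 ler_pM// le_max lexx.
by rewrite mulrC ler_pM2r// le_max lexx orbT.
Qed.

Section Doubling.
Variables A B : int.
Hypotheses (AT : `|A%:~R| <= T ^+ 2) (BT : `|B%:~R| <= T ^+ 3).
Hypothesis disc0 : cubic_disc A B != 0.
Let dbl P := padd A B P P.

Let T0 : 0 < T. Proof. exact: lt_le_trans T1. Qed.

(* If [P] is a 2-torsion point then the denominator vanishes; taking [k] to be
   the numerator, [(f, g) = (1, 0)] represents the point at infinity. *)
Lemma doublingP P : on_curve A B P -> P != None ->
  exists a b f g k : int, [/\ wht P = ln (wsize T a b), b != 0, k != 0,
   coprimez a b & [/\ dup_num A B a b = k * f, dup_den A B a b = k * g,
    0 < wsize T f g & wht (dbl P) = ln (wsize T f g)]].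
Proof.
case: P => [[x y]|//] /= xy _.
have cop : coprimez (numq x) (denq x) by exact: coprime_num_den.
have b0 := denq_neq0 x.
set a := numq x; set b := denq x in b0 *.
have [y0|y0] := eqVneq y 0.
  have G0 : dup_den A B a b = 0.
    apply: (@intr_inj rat); rewrite dup_den_intr /dup_den.
    move: xy; rewrite y0 -[x]divq_num_den -/a -/b expr0n /= => /eqP e.
    have b0' : b%:~R != 0 :> rat by rewrite intr_eq0.
    transitivity (4 * (b%:~R : rat) ^+ 4
      * ((a%:~R / b%:~R) ^+ 3 + A%:~R * (a%:~R / b%:~R) + B%:~R)).
      by field.
    by rewrite -e mulr0.
  exists a, b, 1, 0, (dup_num A B a b); split => //.
    (* If the numerator vanished too, [wsize_dup_ge] would bound a positive quantity by 0. *)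
    apply/negP => /eqP F0.
    have := @wsize_dup_ge R T A B T1 AT BT a b.
    rewrite F0 G0 {2}/wsize normr0 mulr0 maxxx mulr0.
    apply/negP; rewrite -ltNge; apply: mulr_gt0.
      by apply: mulr_gt0; [rewrite ltr0n|rewrite normr_gt0 intr_eq0].
    by rewrite exprn_gt0// (lt_le_trans ltr01)// wsize_ge1.
  rewrite mulr1 mulr0 G0; split => //.
    by rewrite /wsize normr1 lt_max ltr01.
  rewrite /dbl /= eqxx y0 oppr0 eqxx /= /wsize normr0 mulr0 normr1.
  by rewrite max_l// ln1.
have yN : (y == - y) = false.
  by apply/negbTE; rewrite -addr_eq0 -mulr2n mulrn_eq0.
have b0' : b%:~R != 0 :> rat by rewrite intr_eq0.
have xab : x = a%:~R / b%:~R by rewrite divq_num_den.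
have [eG] := tangent_x y0 b0'
  (etrans (eqP xy) (congr1 (fun z => z ^+ 3 + A%:~R * z + B%:~R) xab)).
rewrite -xab -dup_num_intr -dup_den_intr => e.
have G0 : dup_den A B a b != 0.
  rewrite -(intr_eq0 rat) dup_den_intr eG.
  by apply: mulf_neq0; [apply: mulf_neq0|]; rewrite ?expf_neq0// pnatr_eq0.
set x3 := (_ - _ - _) in e.
have [k k0 [eF' eG']] := rat_mul_intP G0 e.
exists a, b, (numq x3), (denq x3), k; split=> //; split=> //.
  by rewrite (lt_le_trans ltr01)// wsize_ge1.
by rewrite /dbl /= eqxx yN /=.
Qed.

Lemma wht_double_le P : on_curve A B P -> wht (dbl P) <= 4 * wht P + ln 12.
Proof.
have l12 : 0 <= ln 12 :> R by rewrite ln_ge0// ler1n.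
case: (eqVneq P None) => [-> _|PN cP]; first by rewrite /= mulr0 add0r.
have [a [b [f [g [k [-> b0 k0 ab [eF eG fg0 ->]]]]]]] := doublingP cP PN.
have w1 : 1 <= wsize T a b by exact: wsize_ge1.
have w0 : 0 < wsize T a b by exact: lt_le_trans w1.
have := wsize_dup_le T1 AT BT a b; rewrite eF eG wsizeM => h.
rewrite mulr_natl -lnXn// -lnM ?posrE ?exprn_gt0 ?ltr0n//.
apply: ler_ln_gt0 => //; rewrite mulrC; apply: le_trans h.
by rewrite ler_peMl ?norm_int_ge1// ltW.
Qed.

Lemma wht_double_ge P : on_curve A B P ->
  4 * wht P - ln (619 * T ^+ 6) <= wht (dbl P).
Proof.
have T6 : 1 <= T ^+ 6 by rewrite exprn_ege1.
have C1 : 1 <= 619 * T ^+ 6.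
  by apply: le_trans T6 _; rewrite ler_peMl ?ler1n// exprn_ge0// ltW.
have C0 : 0 < 619 * T ^+ 6 by exact: lt_le_trans C1.
case: (eqVneq P None) => [-> _|PN cP].
  by rewrite /= mulr0 add0r oppr_le0 ln_ge0.
have [a [b [f [g [k [-> b0 k0 ab [eF eG fg0 ->]]]]]]] := doublingP cP PN.
have w1 : 1 <= wsize T a b by exact: wsize_ge1.
have w0 : 0 < wsize T a b by exact: lt_le_trans w1.
rewrite lerBlDr mulr_natl -lnXn// -lnM ?posrE//.
apply: ler_ln_gt0; first exact: exprn_gt0.
by rewrite mulrC; exact: (wsize_reduced_dup_ge T1 AT BT disc0 ab k0 eF eG).
Qed.

End Doubling.
End WeightedHeight.

(** * Tate's limit *)

Section TateLimit.
Variable R : realType.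
Local Open Scope classical_set_scope.

Lemma cvg_div_exp4 (c : R) : (fun n => c / 4 ^+ n) @ \oo --> (0 : R).
Proof.
rewrite (_ : (fun n => _) = geometric c (4^-1)); last first.
  by apply/funext => n; rewrite /= exprVn.
by apply: cvg_geometric; rewrite ger0_norm ?invr_ge0 ?ler0n// invf_lt1 ?ltr0n// ltr1n.
Qed.

(** The limit is squeezed between a nondecreasing and a nonincreasing correction of [u n / 4 ^+ n].
    Since [v] stays within [e] of [u], division by [4 ^+ n] gives both the same limit. *)
Lemma tate_limit_bounds (u v : nat -> R) (c1 c2 e : R) :
  (forall n, 0 <= u n) -> (forall n, u n.+1 <= 4 * u n + c1) ->
  (forall n, 4 * u n - c2 <= u n.+1) ->
  (forall n, v n <= u n <= v n + e) ->
  u 0%N - c2 / 3 <= limn (fun n => v n / 4 ^+ n) <= u 0%N + c1 / 3.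
Proof.
move=> u0 uS_le uS_ge uv.
pose w n := u n / 4 ^+ n.
have p4 n : 0 < 4 ^+ n :> R by rewrite exprn_gt0// ltr0n.
(* The tail of the errors [c / 4 ^+ k] over [k > n] sums to [(c / 3) / 4 ^+ n]; adding it makes the
   sequences monotone. *)
pose hi n := w n + (c1 / 3) / 4 ^+ n; pose lo n := w n + (- (c2 / 3)) / 4 ^+ n.
have hi_dec : nonincreasing_seq hi.
  apply/nonincreasing_seqP => n; rewrite /hi /w -!mulrDl exprSr invfM mulrA.
  rewrite ler_pdivrMr ?ltr0n// mulrAC ler_pM2r ?invr_gt0//.
  by have := uS_le n; lra.
have lo_inc : nondecreasing_seq lo.
  apply/nondecreasing_seqP => n; rewrite /lo /w -!mulrDl exprSr invfM mulrA.
  rewrite ler_pdivlMr ?ltr0n// mulrAC ler_pM2r ?invr_gt0//.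
  by have := uS_ge n; lra.
have hi_cvg : cvgn hi.
  apply: nonincreasing_is_cvgn => //; exists (- `|c1 / 3|) => _ [n _ <-].
  rewrite /hi -[X in X <= _]add0r; apply: lerD.
    by rewrite /w divr_ge0// ltW.
  rewrite lerNl -mulNr; apply: le_trans (ler_norm _) _.
  rewrite normrM normrN ler_piMr// ger0_norm ?invr_ge0 ?(ltW (p4 n))//.
  by rewrite invf_le1// exprn_ege1// ler1n.
have wL : w @ \oo --> limn hi.
  rewrite (_ : w = fun n => hi n - (c1 / 3) / 4 ^+ n); last first.
    by apply/funext => n; rewrite /hi addrK.
  rewrite -[X in _ --> X]subr0; apply: cvgB => //; exact: cvg_div_exp4.
have loL : lo @ \oo --> limn hi.
  rewrite -[X in _ --> X]addr0; apply: cvgD => //; exact: cvg_div_exp4.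
have vL : (fun n => v n / 4 ^+ n) @ \oo --> limn hi.
  apply: (@squeeze_cvgr _ _ _ _ (fun n => w n - e / 4 ^+ n) w) => //.
    near=> n; rewrite /w -mulrBl !ler_pM2r ?invr_gt0//.
    by have /andP[h1 h2] := uv n; rewrite h1 lerBlDr h2.
  rewrite -[X in _ --> X]subr0; apply: cvgB => //; exact: cvg_div_exp4.
rewrite (cvg_lim _ vL)//; apply/andP; split.
  have := @nondecreasing_cvgn_le _ _ lo_inc (cvgP _ loL) 0%N.
  by rewrite (cvg_lim _ loL)// /lo /w expr0 !divr1.
have := @nonincreasing_cvgn_ge _ _ hi_dec hi_cvg 0%N.
by rewrite /hi /w expr0 !divr1.
Unshelve. all: by end_near.
Qed.
End TateLimit.

(** * Comparison of canonical and weighted heights *)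

Section CanonicalHeight.
Variables (R : realType) (T : R) (A B : int).
Hypotheses (T1 : 1 <= T) (AT : `|A%:~R| <= T ^+ 2) (BT : `|B%:~R| <= T ^+ 3).
Hypothesis disc0 : cubic_disc A B != 0.

(** Tate's argument along the doubling orbit, with [u] the weighted height, [v] the naive height and
    [e = ln T]. *)
Lemma hhat_bounds P : on_curve A B P ->
  wht T P - ln (619 * T ^+ 6) / 3 <= hhat R A B P <= wht T P + ln 12 / 3.
Proof.
move=> cP; set dP := fun n => iter n (fun S => padd A B S S) P.
have cdP n : on_curve A B (dP n).
  by elim: n => [//|n ih] /=; exact: on_curve_double.
apply: (@tate_limit_bounds R (fun n => wht T (dP n))
  (fun n => hpt R (dP n)) _ _ (ln T)) => n.
- exact: wht_ge0.
- exact: wht_double_le.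
- exact: wht_double_ge.
- by rewrite hpt_le_wht// wht_le_hpt.
Qed.
End CanonicalHeight.

(** Integral closedness of the integers in degree two; it serves to make [y1 * y2 * s ^+ 3] an
    integer. *)
Lemma sqr_int_is_int (q : rat) (n : int) : q ^+ 2 = n%:~R -> exists m : int, q = m%:~R.
Proof.
move=> e; suff /eqP d1 : denq q == 1.
  by exists (numq q); rewrite numqE d1 mulr1.
have e2 : numq q ^+ 2 = n * denq q ^+ 2.
  by apply: (@intr_inj rat); rewrite rmorphXn [RHS]rmorphM rmorphXn /= numqE -e; ring.
have cop : coprimez (numq q) (denq q) by exact: coprime_num_den.
have : (denq q ^+ 2 %| numq q ^+ 2)%Z by rewrite e2 dvdz_mull.
rewrite dvdz_pexp2r// => d.
have : (denq q %| gcdz (numq q) (denq q))%Z by rewrite dvdz_gcd d dvdzz.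
rewrite (eqP cop) dvdz1 => /eqP h.
by rewrite -(gtr0_norm (denq_gt0 q)) -abszE h.
Qed.

(** * Height of a sum *)

(** Each [y^2] is at most [3 x^3], and the terms contribute [2 * 2 + 2 + 2 * 3 = 12] times
    [x1 * x2 ^+ 2]. *)
Lemma chord_num_le (F : realFieldType) (a b x1 x2 y1 y2 : F) :
  0 <= x1 -> x1 <= x2 -> `|a| <= x1 ^+ 2 -> `|b| <= x1 ^+ 3 ->
  y1 ^+ 2 = x1 ^+ 3 + a * x1 + b -> y2 ^+ 2 = x2 ^+ 3 + a * x2 + b ->
  `|(x1 * x2 + a) * (x1 + x2) + 2 * b - 2 * (y1 * y2)| <= 12 * (x1 * x2 ^+ 2).
Proof.
move=> x10 x12 ax1 bx1 e1 e2.
have x20 : 0 <= x2 by exact: le_trans x12.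
have ax2 : `|a| <= x2 ^+ 2 by apply: le_trans ax1 _; rewrite lerXn2r ?nnegrE.
have bx2 : `|b| <= x2 ^+ 3 by apply: le_trans bx1 _; rewrite lerXn2r ?nnegrE.
have ysq x y : 0 <= x -> `|a| <= x ^+ 2 -> `|b| <= x ^+ 3 ->
    y ^+ 2 = x ^+ 3 + a * x + b -> `|y| ^+ 2 <= 3 * x ^+ 3.
  move=> x0 ax bx e; rewrite real_normK ?num_real// e.
  apply: le_trans (ler_norm _) _.
  have hx : `|x| <= x by rewrite ger0_norm.
  have -> : 3 * x ^+ 3 = x ^+ 3 + x ^+ 2 * x + x ^+ 3 by ring.
  exact: normD_le (normD_le (normX_le 3 hx) (normM_le ax hx)) bx.
have ry1 := ysq _ _ x10 ax1 bx1 e1; have ry2 := ysq _ _ x20 ax2 bx2 e2.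
have p0 : 0 <= x1 * x2 ^+ 2 by rewrite mulr_ge0// exprn_ge0.
have yy : `|y1 * y2| <= 3 * (x1 * x2 ^+ 2).
  have q0 : 0 <= 3 * (x1 * x2 ^+ 2) by apply: mulr_ge0.
  rewrite -(@ler_pXn2r _ 2)// normrM exprMn.
  apply: le_trans (ler_pM (exprn_ge0 _ (normr_ge0 _))
    (exprn_ge0 _ (normr_ge0 _)) ry1 ry2) _.
  (* The two squares differ only in one factor, [x1] against [x2]. *)
  have -> : 3 * x1 ^+ 3 * (3 * x2 ^+ 3) = 9 * (x1 ^+ 2 * x2 ^+ 3) * x1 by ring.
  have -> : (3 * (x1 * x2 ^+ 2)) ^+ 2 = 9 * (x1 ^+ 2 * x2 ^+ 3) * x2 by ring.
  apply: ler_wpM2l => //; apply: mulr_ge0 => //; apply: mulr_ge0; exact: exprn_ge0.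
have hx1 : `|x1| <= x2 by rewrite ger0_norm.
have hx1' : `|x1| <= x1 by rewrite ger0_norm.
have hx2 : `|x2| <= x2 by rewrite ger0_norm.
have ha : `|a| <= x1 * x2.
  by apply: le_trans ax1 _; rewrite expr2 ler_wpM2l.
have hb : `|b| <= x1 * x2 ^+ 2.
  by apply: le_trans bx1 _; rewrite exprS ler_wpM2l// lerXn2r ?nnegrE.
apply: le_trans (normD_le (normD_le (normM_le (normD_le (normM_le hx1' hx2) ha)
  (normD_le hx1 hx2)) (normM_le (norm_nat_le F 2) hb))
  (normN_le (normM_le (norm_nat_le F 2) yy))) _.
by rewrite le_eqVlt; apply/orP; left; apply/eqP; ring.
Qed.

(** [x(P+Q)] is [(x1 x2 + A)(x1 + x2) + 2B - 2 y1 y2] over [(x1 - x2)^2]. Because the two points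
    share the denominator [s], clearing it leaves just one factor [s] below. *)
Lemma chord_x_ratio (A B n1 n2 s : int) (y1 y2 : rat) :
  let x1 : rat := n1%:~R / s%:~R in let x2 : rat := n2%:~R / s%:~R in
  s != 0 -> x1 != x2 ->
  y1 ^+ 2 = x1 ^+ 3 + A%:~R * x1 + B%:~R ->
  y2 ^+ 2 = x2 ^+ 3 + A%:~R * x2 + B%:~R ->
  exists N : int,
    (((y2 - y1) / (x2 - x1)) ^+ 2 - x1 - x2) * (s * (n1 - n2) ^+ 2)%:~R = N%:~R
    /\ N%:~R = s%:~R ^+ 3 *
      ((x1 * x2 + A%:~R) * (x1 + x2) + 2 * B%:~R - 2 * (y1 * y2)).
Proof.
move=> x1 x2 s0 x12 e1 e2.
have s0' : s%:~R != 0 :> rat by rewrite intr_eq0.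
have d0 : x2 - x1 != 0 by rewrite subr_eq0 eq_sym.
have en1 : n1%:~R = x1 * s%:~R by rewrite divfK.
have en2 : n2%:~R = x2 * s%:~R by rewrite divfK.
(* The square of [y1 * y2 * s ^+ 3] is the product of the integers [y1^2 s^3] and [y2^2 s^3]. *)
have [m em] : exists m : int, y1 * y2 * s%:~R ^+ 3 = m%:~R.
  apply: (@sqr_int_is_int _ ((n1 ^+ 3 + A * n1 * s ^+ 2 + B * s ^+ 3)
    * (n2 ^+ 3 + A * n2 * s ^+ 2 + B * s ^+ 3))).
  rewrite !(rmorphM, rmorphD, rmorphXn)/= en1 en2.
  transitivity (y1 ^+ 2 * y2 ^+ 2 * s%:~R ^+ 6); first by ring.
  by rewrite e1 e2; ring.
exists ((n1 * n2 + A * s ^+ 2) * (n1 + n2) + 2 * B * s ^+ 3 - 2 * m).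
have e : ((n1 * n2 + A * s ^+ 2) * (n1 + n2) + 2 * B * s ^+ 3 - 2 * m)%:~R =
  s%:~R ^+ 3 * ((x1 * x2 + A%:~R) * (x1 + x2) + 2 * B%:~R - 2 * (y1 * y2)).
  rewrite !(rmorphM, rmorphB, rmorphD, rmorphXn)/= en1 en2 -em; ring.
split=> //; rewrite e !(rmorphM, rmorphB, rmorphXn)/= en1 en2.
clear e em m en1 en2; move: x1 x2 d0 e1 e2 {x12} => x1 x2 d0 e1 e2.
have -> : B%:~R = y1 ^+ 2 - x1 ^+ 3 - A%:~R * x1 by rewrite e1; ring.
have -> : A%:~R = ((y2 ^+ 2 - x2 ^+ 3) - (y1 ^+ 2 - x1 ^+ 3)) / (x2 - x1).
  by rewrite e1 e2; field.
by field.
Qed.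

Section Sum.
Variables (R : realType) (T : R) (A B : int).
Hypotheses (T1 : 1 <= T) (AT : `|A%:~R| <= T ^+ 2) (BT : `|B%:~R| <= T ^+ 3).

(** The numerator is bounded by [chord_num_le] scaled by [s^3]; the weighted denominator
    [T s (n1 - n2)^2] is at most [n1 n2^2], since [T s <= n1] and [0 < n2 - n1 < n2]. *)
Lemma wht_sum_le (n1 n2 s : int) (y1 y2 : rat) :
  let x1 : rat := n1%:~R / s%:~R in let x2 : rat := n2%:~R / s%:~R in
  0 < s -> T <= ratr x1 -> x1 < x2 ->
  on_curve A B (Some (x1, y1)) -> on_curve A B (Some (x2, y2)) ->
  wht T (padd A B (Some (x1, y1)) (Some (x2, y2)))
  <= ln (12 * (n1%:~R * n2%:~R ^+ 2)).
Proof.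
move=> x1 x2 s0 Tx1 x12 /eqP e1 /eqP e2.
have T0 : 0 < T by exact: lt_le_trans T1.
have x10 : 0 < x1 by rewrite -(ltr_rat R) rmorph0 (lt_le_trans T0).
have sn0 : s != 0 by rewrite gt_eqF.
have s0' : 0 < s%:~R :> rat by rewrite ltr0z.
have x12n : x1 != x2 by rewrite lt_eqF.
have en1 : n1%:~R = x1 * s%:~R by rewrite divfK ?gt_eqF.
have en2 : n2%:~R = x2 * s%:~R by rewrite divfK ?gt_eqF.
have int_le (k : int) n : `|k%:~R| <= T ^+ n -> `|k%:~R| <= x1 ^+ n.
  move=> h; rewrite -(ler_rat R) rmorphXn /= ratr_norm ratr_int.
  by apply: le_trans h _; rewrite lerXn2r// nnegrE ?(ltW T0)// (le_trans (ltW T0)).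
have [N [eN eN']] := chord_x_ratio sn0 x12n e1 e2.
have n10 : 0 < n1 by rewrite -(ltr0z rat) en1 mulr_gt0.
have n12 : n1 < n2 by rewrite -(ltr_int rat) en1 en2 ltr_pM2r.
have n20 : 0 < n2 by exact: lt_trans n12.
have D0 : s * (n1 - n2) ^+ 2 != 0.
  by rewrite mulf_neq0// expf_neq0// subr_eq0 lt_eqF.
have NN : `|N| <= 12 * (n1 * n2 ^+ 2).
  rewrite -(ler_int rat) intr_norm eN' normrM normrX (gtr0_norm s0').
  apply: le_trans (ler_wpM2l _ (chord_num_le (ltW x10) (ltW x12)
    (int_le _ _ AT) (int_le _ _ BT) e1 e2)) _; first by rewrite exprn_ge0 ?ltW.
  rewrite le_eqVlt; apply/orP; left; apply/eqP.
  by rewrite !(rmorphM, rmorphXn)/= en1 en2; ring.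
rewrite [padd _ _ _ _]/padd (negPf x12n) /=.
apply: le_trans (wht_ratio_le T1 0 D0 eN) _.
apply: ler_ln_gt0; first by rewrite (lt_le_trans ltr01)// wsize_ge1.
have p0 : 0 < n1%:~R * n2%:~R ^+ 2 :> R by rewrite mulr_gt0 ?exprn_gt0 ?ltr0z.
rewrite /wsize ge_max; apply/andP; split.
  by move: NN; rewrite -(ler_int R) intr_norm !(rmorphM, rmorphXn)/= rmorph_nat.
apply: (@le_trans _ _ (n1%:~R * n2%:~R ^+ 2)); last first.
  by apply: ler_peMl; [exact: ltW | rewrite ler1n].
rewrite ger0_norm; last by rewrite ler0z mulr_ge0 ?exprn_even_ge0// ltW.
rewrite intrM mulrA rmorphXn /=; apply: ler_pM.
- by apply: mulr_ge0; [exact: ltW | rewrite ler0z ltW].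
- by rewrite exprn_even_ge0.
- move: Tx1; rewrite /x1 rmorphM fmorphV /= !ratr_int ler_pdivlMr//.
  by rewrite ltr0z.
- rewrite -sqrrN -rmorphN /= opprB lerXn2r ?nnegrE ?ler0z ?ler_int ?subr_ge0 ?ltW//.
  by rewrite gtrBl.
Qed.

(** Reducing [n / s] removes a divisor of [gcdz n s], and the reduced numerator is at most the
    weighted size. *)
Lemma ln_num_le (n s : int) (y : rat) :
  let x : rat := n%:~R / s%:~R in
  0 < s -> 0 < n -> ln n%:~R <= wht T (Some (x, y)) + ln (gcdz n s)%:~R.
Proof.
move=> x s0 n0; have sn0 : s != 0 by rewrite gt_eqF.
have [k k0 [en es]] : exists2 k : int, k != 0 & n = k * numq x /\ s = k * denq x.
  by apply: rat_mul_intP => //; rewrite divfK// intr_eq0.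
have g0 : gcdz n s != 0 by rewrite gcdz_eq0 (negPf sn0) andbF.
have /dvdzP[q eq] : (k %| gcdz n s)%Z.
  by rewrite dvdz_gcd [X in (k %| X)%Z && _]en [X in _ && (k %| X)%Z]es !dvdz_mulr.
have q0 : q != 0 by apply: contra_neq g0; rewrite eq => ->; rewrite mul0r.
have w1 : 1 <= wsize T (numq x) (denq x) by exact: wsize_ge1.
have gp : 0 < (gcdz n s)%:~R :> R by rewrite ltr0z lt_neqAle eq_sym g0.
have w0 : 0 < wsize T (numq x) (denq x) by exact: lt_le_trans w1.
rewrite /= -lnM ?posrE//; apply: ler_ln_gt0.
  by rewrite ltr0z.
have nn : 0 < n%:~R :> R by rewrite ltr0z.
rewrite -[X in X <= _](gtr0_norm nn) -/x.
rewrite [X in `|X%:~R|]en intrM normrM mulrC; apply: ler_pM => //.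
  by rewrite le_max lexx.
rewrite -[X in _ <= X]gtr0_norm// eq intrM normrM ler_peMl// norm_int_ge1//.
Qed.
End Sum.

(** * From heights to the cosine *)

Lemma cubic_disc_model_neq0 a1 a2 a3 a4 a6 : wdisc a1 a2 a3 a4 a6 != 0 ->
  cubic_disc (modelA a1 a2 a3 a4 a6) (modelB a1 a2 a3 a4 a6) != 0.
Proof.
move=> d0; rewrite cubic_disc_model; apply: mulf_neq0 d0.
by rewrite oppr_eq0 !mulf_eq0 !pnatr_eq0.
Qed.

Lemma bigX_bounds (R : realType) (A B : int) :
  let X : R := (bigX A B)%:~R in let T := powR X (6^-1) in
  [/\ T ^+ 6 = X, `|A%:~R| <= T ^+ 2 & `|B%:~R| <= T ^+ 3].
Proof.
move=> X T.
have X0 : 0 <= X by rewrite ler0z le_max exprn_ge0.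
have T0 : 0 <= T by exact: powR_ge0.
have TX : T ^+ 6 = X.
  by rewrite -powR_mulrn// -powRrM mulVf ?powRr1// pnatr_eq0.
have AX : `|A%:~R| ^+ 3 <= X.
  by rewrite -intr_norm -rmorphXn /= ler_int le_max lexx.
have BX : `|B%:~R| ^+ 2 <= X.
  by rewrite -intr_norm -rmorphXn /= ler_int le_max lexx orbT.
split=> //.
  by rewrite -(@ler_pXn2r _ 3) ?nnegrE ?exprn_ge0// -exprM TX.
by rewrite -(@ler_pXn2r _ 2) ?nnegrE ?exprn_ge0// -exprM TX.
Qed.

(** With [S] the geometric mean of [Hp] and [Hq], one has [Hq <= sqrt alpha * S] and [L <= S / M];
    dividing [Hq + 3 c L + 2 L] by [2 S] gives the three terms. *)
Lemma cos_bound (R : realType) (H Hp Hq L c M alpha : R) :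
  0 < M -> 0 < L -> 0 <= c -> M * L < Hp -> M * L < Hq ->
  Hq / Hp <= alpha -> H <= Hp + 2 * Hq + 3 * (c * L) + 2 * L ->
  (H - Hp - Hq) / (2 * Num.sqrt (Hp * Hq))
  <= Num.sqrt alpha / 2 + 3 * c / (2 * M) + M^-1.
Proof.
move=> M0 L0 c0 MHp MHq qp HH.
have ML0 : 0 < M * L by exact: mulr_gt0.
have Hp0 : 0 < Hp by exact: lt_trans MHp.
have Hq0 : 0 < Hq by exact: lt_trans MHq.
have a0 : 0 <= alpha by apply: le_trans qp; rewrite divr_ge0// ltW.
set S := Num.sqrt _.
have MLS : M * L <= S.
  rewrite -[M * L](gtr0_norm ML0) -sqrtr_sqr ler_wsqrtr// expr2.
  by apply: ler_pM; exact: ltW.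
have S0 : 0 < S by exact: lt_le_trans MLS.
have HqS : Hq <= Num.sqrt alpha * S.
  rewrite -sqrtrM// -[X in X <= _](gtr0_norm Hq0) -sqrtr_sqr.
  rewrite ler_wsqrtr// mulrA expr2; apply: ler_wpM2r; first exact: ltW.
  by rewrite -ler_pdivrMr.
have LS : L <= S / M by rewrite ler_pdivlMr// mulrC.
rewrite ler_pdivrMr; last by rewrite mulr_gt0.
have -> : (Num.sqrt alpha / 2 + 3 * c / (2 * M) + M^-1) * (2 * S)
  = Num.sqrt alpha * S + 3 * (c * (S / M)) + 2 * (S / M).
  by field; rewrite lt0r_neq0.
have cLS : c * L <= c * (S / M) by exact: ler_wpM2l.
by lra.
Qed.

Theorem theorem3p5 (R : realType) (delta gamma M alpha : R) :
  0 <= delta -> delta <= 1 -> 0 < gamma -> 0 < M -> 1 < alpha ->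
  exists X0 : R,
  forall (a1 a2 a3 a4 a6 : int) (x1 x2 : int) (s : nat) (yP yQ : rat),
    global_minimal a1 a2 a3 a4 a6 ->
    let A := modelA a1 a2 a3 a4 a6 in
    let B := modelB a1 a2 a3 a4 a6 in
    let X : R := (bigX A B)%:~R in
    X0 <= X ->
    (0 < s)%N ->
    let xP : rat := x1%:~R / s%:R in
    let xQ : rat := x2%:~R / s%:R in
    let P : ecpoint := Some (xP, yP) in
    let Q : ecpoint := Some (xQ, yQ) in
    on_curve A B P -> on_curve A B Q ->
    powR X (6^-1) <= ratr xP -> xP < xQ ->
    (gcdz x1 s)%:~R <= powR (s%:R : R) delta ->
    (gcdz x2 s)%:~R <= powR (s%:R : R) delta ->
    hrat R (s%:R) <= gamma^-1 * ln X ->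
    M * ln X < hhat R A B P -> M * ln X < hhat R A B Q ->
    Num.max (hhat R A B Q / hhat R A B P) (hhat R A B P / hhat R A B Q) <= alpha ->
    cos_theta R A B P Q <= Num.sqrt alpha / 2 + 3 * delta / (2 * M * gamma) + M^-1.
Proof.
(* The accumulated constant is [(4/3) ln 12 + ln 619], at most [ln (12 * 12 * 619)], which the
   second [ln X] absorbs. *)
move=> d0 _ g0 M0 _; exists (12 * 12 * 619) => a1 a2 a3 a4 a6 x1 x2 s yP yQ.
move=> [disc0 _] A B X X0 s0 xP xQ P Q cP cQ TP PQ g1 g2 hs MP MQ.
rewrite ge_max => /andP[qp _].
have [TX AT BT] := bigX_bounds R A B; rewrite -/X in TX AT BT TP.
set T := powR X _ in TX AT BT TP.
have {}disc0 : cubic_disc A B != 0 by exact: cubic_disc_model_neq0.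
have X1 : 1 < X by apply: lt_le_trans X0; lra.
have L0 : 0 < ln X by exact: ln_gt0.
have T1 : 1 <= T by rewrite -(@expr_ge1 _ 6) ?powR_ge0// TX ltW.
have T0 : 0 < T by exact: lt_le_trans T1.
have s0z : 0 < s%:Z by rewrite ltz_nat.
have s0q : 0 < s%:R :> rat by rewrite ltr0n.
have xP0 : 0 < xP by rewrite -(ltr_rat R) rmorph0 (lt_le_trans T0).
have n1 : 0 < x1 by rewrite -(ltr0z rat) -(@pmulr_lgt0 _ s%:R^-1) ?invr_gt0.
have n2 : 0 < x2.
  rewrite -(ltr0z rat) -(@pmulr_lgt0 _ s%:R^-1) ?invr_gt0//.
  exact: lt_trans PQ.
have xPQ : xP != xQ by rewrite lt_eqF.
have /andP[hP _] := hhat_bounds T1 AT BT disc0 cP.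
have /andP[hQ _] := hhat_bounds T1 AT BT disc0 cQ.
have /andP[_ hPQ] := hhat_bounds T1 AT BT disc0 (on_curve_chord xPQ cP cQ).
have wPQ := @wht_sum_le R T A B T1 AT BT x1 x2 s yP yQ s0z TP PQ cP cQ.
have lP := @ln_num_le R T T1 x1 s yP s0z n1.
have lQ := @ln_num_le R T T1 x2 s yQ s0z n2.
(* As an integer, [s] has denominator 1, so its height is [ln s]. *)
have lns : ln (s%:R : R) <= gamma^-1 * ln X.
  apply: le_trans hs; rewrite /hrat -[s%:R in X in _ <= X]/(s%:Z%:~R).
  rewrite numq_int denq_int /=.
  by rewrite (maxn_idPl _).
have lng (x : int) : (gcdz x s)%:~R <= powR (s%:R : R) delta ->
    ln ((gcdz x s)%:~R : R) <= delta / gamma * ln X.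
  move=> h; apply: (@le_trans _ _ (ln (powR (s%:R : R) delta))).
    apply: ler_ln_gt0 => //; rewrite ltr0z lt_neqAle eq_sym gcdz_eq0.
    by rewrite (gt_eqF s0z) andbF.
  by rewrite ln_powR -mulrA ler_wpM2l.
have {}g1 := lng _ g1; have {}g2 := lng _ g2.
have r1 : 0 < x1%:~R :> R by rewrite ltr0z.
have r2 : 0 < x2%:~R :> R by rewrite ltr0z.
have c12 : 0 < 12 :> R by rewrite ltr0n.
have c619 : 0 < 619 :> R by rewrite ltr0n.
have elog : ln (12 * (x1%:~R * x2%:~R ^+ 2) : R)
    = ln 12 + (ln x1%:~R + 2 * ln x2%:~R).
  rewrite lnM ?posrE ?mulr_gt0 ?exprn_gt0//.
  by rewrite lnM ?posrE ?exprn_gt0// lnXn// mulr_natl.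
have eC : ln (619 * T ^+ 6 : R) = ln 619 + ln X.
  by rewrite TX lnM ?posrE// (lt_trans ltr01).
have lX0 : 2 * ln 12 + ln 619 <= ln X :> R.
  have c144 : 0 < 12 * 12 :> R by exact: mulr_gt0.
  rewrite mulr_natl mulr2n -(@lnM R 12 12)// -(@lnM R (12 * 12) 619)//.
  by apply: ler_ln_gt0 X0; exact: mulr_gt0.
have l12 : 0 <= ln 12 :> R by rewrite ln_ge0// ler1n.
rewrite eC in hP hQ; rewrite elog in wPQ.
rewrite /cos_theta; set H := hhat R A B (padd A B P Q) in hPQ *.
have -> : 3 * delta / (2 * M * gamma) = 3 * (delta / gamma) / (2 * M).
  by field; rewrite !lt0r_neq0.
apply: (@cos_bound R _ _ _ (ln X)) => //; first by rewrite divr_ge0// ltW.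
change (s%:Z%:~R : rat) with (s%:R : rat) in wPQ, lP, lQ.
rewrite -/xP -/xQ -/P -/Q in wPQ lP lQ.
(* With heights and logarithms abstracted, the required bound is a linear combination of these
   inequalities. *)
move: hP hQ hPQ wPQ lP lQ g1 g2.
move: H (hhat R A B P) (hhat R A B Q) (wht T P) (wht T Q) (wht T _).
move=> H Hp Hq wP wQ wS.
move: (delta / gamma * ln X) => dgX.
by clear -lX0 l12; move=> *; lra.
Qed.
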